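(* Let $p>7$ be a prime with $p\equiv 3\pmod 4$, and let $n,k$ be positive integers with $\gcd(n,k)=1$ and $\frac{2n}{\gcd(2n,k)}$ even. Let $F(x)=x^{\frac{p^k+1}{2}}$ over $\mathbb{F}_{p^n}$. If $n$ is odd, the $(-1)$-differential spectrum of $F$ is $$\mathbb S=\left\{{}_{-1}\omega_0=\frac{p^n(3p-1)-(p+5)}{4(p+1)},\ {}_{-1}\omega_2=\frac{p^n-3}{4},\ {}_{-1}\omega_{\frac{p+1}{4}}=1,\ {}_{-1}\omega_{\frac{p+5}{4}}=1,\ {}_{-1}\omega_{\frac{p+1}{2}}=\frac{p^n-p}{p+1}\right\}.$$ If $n$ is even, the $(-1)$-differential spectrum of $F$ is $$\mathbb S=\left\{{}_{-1}\omega_0=\frac{(p^n-1)(3p-1)}{4(p+1)},\ {}_{-1}\omega_2=\frac{p^n-1}{4},\ {}_{-1}\omega_{\frac{p+1}{4}}=1,\ {}_{-1}\omega_{\frac{p+5}{4}}=1,\ {}_{-1}\omega_{\frac{p+1}{2}}=\frac{p^n-p-2}{p+1}\right\}.$$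
   Context: For a power function $F(x)=x^d$ over $\mathbb{F}_q$ and $c\in\mathbb{F}_q$, put ${}_c\delta_F(1,b)=\#\{x\in\mathbb{F}_q : F(x+1)-cF(x)=b\}$ and ${}_c\omega_i=\#\{b\in\mathbb{F}_q : {}_c\delta_F(1,b)=i\}$. Saying that the $c$-differential spectrum is $\mathbb S=\{{}_c\omega_{i}=v_{i},\dots\}$ means that the listed ${}_c\omega_i$ have the listed values (possibly $0$ for small parameters) and ${}_c\omega_j=0$ for every $j$ not listed. Here $c=-1$. *)

(* Defs.v *)
From mathcomp Require Import all_boot all_order all_algebra.

Set Implicit Arguments.
Unset Strict Implicit.
Unset Printing Implicit Defensive.

Import GRing.Theory.
Local Open Scope ring_scope.

Definition power_fun (F : finFieldType) (d : nat) (x : F) : F := x ^+ d.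

Definition cdelta (F : finFieldType) (f : F -> F) (c a b : F) : nat :=
  #|[set x : F | f (x + a) - c * f x == b]|.

Definition comega (F : finFieldType) (f : F -> F) (c : F) (i : nat) : nat :=
  #|[set b : F | cdelta f c 1 b == i]|.

(* The prescribed values are rationals, so that closed formulas involving
   subtraction and division are read exactly rather than with the truncated
   operations of nat. *)
Definition has_cdiff_spectrum (F : finFieldType) (f : F -> F) (c : F)
    (S : seq (nat * rat)) : Prop :=
  (forall iv, iv \in S -> (comega f c iv.1)%:R = iv.2) /\
  (forall j, j \notin [seq iv.1 | iv <- S] -> comega f c j = 0%N).

(* Main.v *)
Require Import Defs.
From mathcomp Require Import all_boot all_order all_algebra.
From mathcomp Require Import all_solvable all_field.
From mathcomp Require Import zify ring.

(* Put 2 d = p^k + 1, q = p^n, and write 4 x + 2 = s + 1/s.  In characteristic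
   p one gets 2 ((x + 1)^d + x^d) = s^d + s^-d, that is, up to affine changes of
   variables, x |-> (x + 1)^d + x^d is a Dickson polynomial of degree d.  Every x
   in F_q comes from exactly two s (counted with multiplicity) in the union of
   the groups of (q - 1)-th and (q + 1)-th roots of unity, on which s |-> s^d is
   a homomorphism.  Its kernel has order (p + 1)/2 on one of these groups and 2
   on the other one, and the fibres are counted on the images: these intersect
   trivially, the first one contains -1 and the second one does not.  The values
   b = 1 and b = -1, which come from w = 1 and w = -1, are the exceptional ones. *)

Set Implicit Arguments.
Unset Strict Implicit.
Unset Printing Implicit Defensive.

Import GRing.Theory.
Local Open Scope ring_scope.

(** * Arithmetic of the exponent: gcds of [d] with [p^n - 1] and [p^n + 1] *)

Section Arithmetic.
Local Open Scope nat_scope.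

Lemma pred_eq_succ m : 0 < m -> (m - 1 == m + 1) = false.
Proof. lia. Qed.

Lemma gcdn_pred_succ m : odd m -> gcdn (m - 1) (m + 1) = 2.
Proof.
case: m => // m m_odd; have -> : m.+1 + 1 = 2 + m by lia.
by rewrite subn1 gcdnDr gcdnC; apply/gcdn_idPl; rewrite dvdn2.
Qed.

Lemma expn_mod_sqr1 g p m :
  p * p = 1 %[mod g] -> p ^ m = (if odd m then p else 1) %[mod g].
Proof.
move=> pp; elim: m => [|m IHm] //; rewrite expnS -modnMmr IHm modnMmr /=.
by case: (odd m); rewrite /= ?pp ?muln1.
Qed.

(** For odd [p], [p^2 - 1 = ((p - 1)/2) * 2 (p + 1)]. The modulus is twice [p + 1] so as to show
    that, for odd [m], [p^m + 1] is an odd multiple of [p + 1]. *)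
Lemma expn_mod_double p m : odd p ->
  p ^ m = (if odd m then p else 1) %[mod 2 * (p + 1)].
Proof.
move=> p_odd; apply: expn_mod_sqr1.
have -> : p * p = (p - 1) %/ 2 * (2 * (p + 1)) + 1.
  rewrite mulnA divnK; last by rewrite dvdn2; lia.
  by case: p p_odd => // p _; nia.
by rewrite modnMDl.
Qed.

(* Both [p^(2 k)] and [p^(2 n)] are 1 mod [g], hence so is [p^2],
   as [gcd(2 k, 2 n) = 2]; [k] being odd, [p^k] is then [p] mod [g]. *)
Lemma dvdn_succ_expn_mod g p n k :
    0 < p -> 0 < k -> odd k -> coprime k n ->
    g %| p ^ k + 1 -> g %| (p ^ n - 1) * (p ^ n + 1) ->
  g %| p + 1 /\ p ^ n = (if odd n then p else 1) %[mod g].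
Proof.
move=> p0 k0 k_odd co_kn gk gn.
have sqr1 m : p ^ m * p ^ m = (p ^ m - 1) * (p ^ m + 1) + 1.
  by have : 0 < p ^ m by [rewrite expn_gt0 p0]; nia.
have pk : p ^ k * p ^ k = 1 %[mod g].
  by rewrite sqr1 -modnDml (eqP (dvdn_mull _ gk)).
have pn : p ^ n * p ^ n = 1 %[mod g] by rewrite sqr1 -modnDml (eqP gn).
have p2 : p * p = 1 %[mod g].
  have [u v uv _] := egcdnP n k0; rewrite (eqP co_kn) in uv.
  have : p ^ (u * k) * p ^ (u * k) = 1 %[mod g].
    by rewrite mulnC mulnC !(mulnC u) !expnM -expnMn -modnXm pk modnXm exp1n.
  have vn : p ^ (v * n) * p ^ (v * n) = 1 %[mod g].
    by rewrite !(mulnC v) !expnM -expnMn -modnXm pn modnXm exp1n.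
  rewrite uv addn1 expnS mulnACA -modnMmr vn modnMmr muln1; exact.
have podd := fun m => expn_mod_sqr1 m p2.
split; last exact: podd.
by move: gk; rewrite /dvdn -modnDml podd k_odd modnDml.
Qed.

Section GcdExponent.
Variables p n k d f : nat.
Hypotheses (f_gt0 : 0 < f) (pE : p + 1 = 4 * f) (k_odd : odd k) (co_kn : coprime k n).
Hypothesis dE : 2 * d = p ^ k + 1.

Let p0 : 0 < p. Proof. lia. Qed.
Let k0 : 0 < k. Proof. by case: k k_odd. Qed.

Let p_odd : odd p. Proof. lia. Qed.

Lemma pexp_mod4f m : p ^ m = (if odd m then p else 1) %[mod 4 * f].
Proof.
have := expn_mod_double m p_odd; rewrite pE => /(congr1 (modn^~ (4 * f))).
by rewrite !modn_dvdm // dvdn_mull.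
Qed.

Lemma pexp_mod4 m : p ^ m = (if odd m then 3 else 1) %[mod 4].
Proof.
have := congr1 (modn^~ 4) (pexp_mod4f m); rewrite !modn_dvdm ?dvdn_mulr // => ->.
by case: (odd m) => //; lia.
Qed.

Let d_even : ~~ odd d.
Proof. by have := pexp_mod4 k; rewrite k_odd; lia. Qed.

(** A common divisor [g] of [d] and [N] divides [p + 1]. For odd [n], [p^n] is [p] mod [g], so [g]
    also divides [p - 1]; for even [n], [p^n] is 1 mod [g], so [p^n + 1] is 2 mod [g]. The parity of
    [N/2] is read off [p^n] mod 4. *)
Lemma gcd_exponent_two N :
    (N == p ^ n - 1) || (N == p ^ n + 1) -> (odd n == (N == p ^ n - 1)) ->
  gcdn d N = 2 /\ odd (N %/ 2).
Proof.
move=> NE nN; have := pexp_mod4 n; have q0 : 0 < p ^ n by rewrite expn_gt0 p0.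
move=> q4; split; last by move: NE nN; case: (odd n) q4 => /=; lia.
apply/eqP; rewrite eqn_dvd dvdn_gcd; apply/andP; split; last first.
  by rewrite !dvdn2 d_even /=; move: NE nN; case: (odd n) q4 => /=; lia.
set g := gcdn d N.
have gk : g %| p ^ k + 1 by rewrite -dE dvdn_mull // dvdn_gcdl.
have gN : g %| N by rewrite dvdn_gcdr.
have gn : g %| (p ^ n - 1) * (p ^ n + 1).
  by case/orP: NE gN => /eqP-> gN; [apply: dvdn_mulr | apply: dvdn_mull].
have [gp pn] := dvdn_succ_expn_mod p0 k0 k_odd co_kn gk gn.
case/orP: NE => /eqP NE; rewrite NE in nN gN.
  rewrite eqxx eqb_id in nN; rewrite nN in pn.
  have gp1 : g %| p - 1.
    by move: gN; rewrite -(@eqn_mod_dvd g (p ^ n) 1) // -(@eqn_mod_dvd g p 1) // pn.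
  by rewrite -(dvdn_addr _ gp1) -[2]/(1 + 1) addnA subnK.
have -> : 2 = 1 + 1 by [].
have nF : odd n = false.
  rewrite [p ^ n + 1 == _]eq_sym pred_eq_succ // eqbF_neg in nN.
  exact/negbTE.
by move: gN; rewrite /dvdn -modnDml pn nF modnDml.
Qed.

(** Here [p + 1 = 4 f] divides [N], and [2 f] divides [d]. The gcd divides [p + 1], which leaves
    only [2 f] and [4 f]. *)
Lemma gcd_exponent_half N :
    (N == p ^ n - 1) || (N == p ^ n + 1) -> (odd n == (N == p ^ n + 1)) ->
  gcdn d N = 2 * f /\ ~~ odd (N %/ (2 * f)).
Proof.
move=> NE nN; have q0 : 0 < p ^ n by rewrite expn_gt0 p0.
have f4 : 4 * f = 2 * (2 * f) by rewrite mulnA.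
have fN : 4 * f %| N.
  have := pexp_mod4f n; case/orP: NE => /eqP NE; rewrite NE in nN *.
    have -> : odd n = false by rewrite pred_eq_succ // eqbF_neg in nN; apply/negbTE.
    by move/eqP; rewrite eqn_mod_dvd.
  by rewrite eqxx eqb_id in nN; rewrite nN /dvdn -modnDml => ->; rewrite modnDml pE modnn.
have fk : 4 * f %| p ^ k + 1.
  by rewrite /dvdn -modnDml pexp_mod4f k_odd modnDml pE modnn.
split; last first.
  by case/dvdnP: fN => c ->; rewrite f4 mulnA mulnK ?muln_gt0 // oddM andbF.
set g := gcdn d N.
have fg : 2 * f %| g.
  rewrite dvdn_gcd (dvdn_trans _ fN) ?andbT; last by rewrite f4 dvdn_mull.
  by rewrite -(@dvdn_pmul2l 2) // dE -f4.
have gk : g %| p ^ k + 1 by rewrite -dE dvdn_mull // dvdn_gcdl.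
have gN : g %| N by rewrite dvdn_gcdr.
have gn : g %| (p ^ n - 1) * (p ^ n + 1).
  by case/orP: NE gN => /eqP-> gN; [apply: dvdn_mulr | apply: dvdn_mull].
have [gp _] := dvdn_succ_expn_mod p0 k0 k_odd co_kn gk gn.
case/dvdnP: fg => c gE; rewrite gE pE in gp.
have f2_gt0 : 0 < 2 * f by rewrite muln_gt0.
have c2 : c <= 2 by rewrite -(leq_pmul2r f2_gt0) -f4 dvdn_leq // muln_gt0.
have gd : g %| d by rewrite dvdn_gcdl.
case: c c2 gE gp => [|[|[|//]]] _ gE;
    first by rewrite mul0n dvd0n f4 !muln_eq0 /= eqn0Ngt f_gt0.
  by rewrite gE mul1n.
(* The gcd [4 f] is excluded: [2 (p + 1)] would divide [2 d = p^k + 1], which is [p + 1] modulo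
   [2 (p + 1)] since [k] is odd. *)
move=> _; have : 2 * (p + 1) %| p ^ k + 1.
  by rewrite -dE dvdn_pmul2l // pE f4 -gE.
rewrite /dvdn -modnDml expn_mod_double // k_odd modnDml modn_small ?addn1 //.
exact: ltn_Pmull.
Qed.
End GcdExponent.

End Arithmetic.

(** * Roots of unity and the power map on them *)

(** [L] is the splitting field of [X^m - 1], which is separable because [m] is nonzero in [F]; its
    [m] distinct roots form a cyclic group. *)
Lemma ex_prim_root_ext (F : finFieldType) (m : nat) :
    (m%:R != 0 :> F) ->
  exists (L : finFieldType) (iota : {rmorphism F -> L}) (z : L),
    m.-primitive_root z.
Proof.
move=> m_neq0.
have m_gt0 : (0 < m)%N by case: m m_neq0 => //; rewrite eqxx.
have nz : ('X^m - 1 : {poly F}) != 0 by rewrite monic_neq0 ?monic_Xn_sub_1.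
have [L [rs Drs _]] := FinSplittingFieldFor nz.
rewrite rmorphB /= map_polyXn rmorph1 in Drs.
have [z z_prim] : exists z : L, m.-primitive_root z.
  have Urs : uniq rs.
    rewrite -separable_prod_XsubC -(eqp_separable Drs).
    by rewrite cyclotomic.separable_Xn_sub_1 // -(rmorph_nat (in_alg L)) fmorph_eq0.
  suff /hasP[z _ z_prim] : has m.-primitive_root rs by exists z.
  apply: has_prim_root => //; last by rewrite
    -ltnS -(size_prod_XsubC _ id) -(eqp_size Drs) size_Xn_sub_1.
  apply/allP=> z rz; rewrite /= unity_rootE.
  have : root ('X^m - 1) z by rewrite (eqp_root Drs) root_prod_XsubC.
  by rewrite /root !hornerE subr_eq0.
by exists (FinFieldExtType L), (in_alg L), z.
Qed.

Definition mu (L : finFieldType) (N : nat) : {set L} := [set s | s ^+ N == 1].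

Definition trace_count (L : finFieldType) (N : nat) (y : L) : nat :=
  #|[set s in mu L N | s + s^-1 == y]|.

Section RootsOfUnity.
Variable L : finFieldType.
Implicit Types (s t w y : L) (N K d : nat).

Lemma mu_neq0 N s : (0 < N)%N -> s \in mu L N -> s != 0.
Proof.
move=> N0; rewrite inE; apply: contraTneq => ->.
by rewrite expr0n gtn_eqF // eq_sym oner_eq0.
Qed.

Lemma muV N s : s \in mu L N -> s^-1 \in mu L N.
Proof. by rewrite !inE exprVn invr_eq1. Qed.

Lemma mu_dvd K N s : (K %| N)%N -> s \in mu L K -> s \in mu L N.
Proof. by rewrite !inE => /dvdnP[c ->] /eqP sK; rewrite mulnC exprM sK expr1n. Qed.

Lemma mu_gcd K N s : (0 < K)%N -> s \in mu L K -> s \in mu L N -> s \in mu L (gcdn K N).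
Proof.
rewrite !inE => K0 /eqP sK; have [m m_prim mK] := prim_order_exists K0 sK.
by rewrite -!(prim_order_dvd m_prim) dvdn_gcd mK.
Qed.

Lemma card_mu M N (z : L) : M.-primitive_root z -> (N %| M)%N -> #|mu L N| = N.
Proof.
move=> z_prim NM; have zN := dvdn_prim_root z_prim NM.
set z' := z ^+ _ in zN.
suff -> : mu L N = [set z' ^+ (i : 'I_N) | i : 'I_N].
  rewrite card_imset ?card_ord // => i j /eqP.
  by rewrite (eq_prim_root_expr zN) !modn_small // => /eqP/val_inj.
apply/setP=> s; rewrite inE; apply/eqP/imsetP => [sN|[i _ ->]].
  by have [i ->] := prim_rootP zN sN; exists i.
by rewrite exprAC (prim_expr_order zN) expr1n.
Qed.

(** On the cyclic group [mu L N] the map [s |-> s^d] has kernel [mu L (gcdn d N)], hence image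
    [mu L (N %/ gcdn d N)]; a nonempty fibre is a coset of the kernel. *)
Lemma card_pow_fiber M N d (z w : L) :
    M.-primitive_root z -> (N %| M)%N -> (0 < d)%N ->
  #|[set s in mu L N | s ^+ d == w]| =
    if w \in mu L (N %/ gcdn d N) then gcdn d N else 0%N.
Proof.
move=> z_prim NM d0; have := dvdn_prim_root z_prim NM.
move: (z ^+ _) => zeta zN.
have N0 := prim_order_gt0 zN.
have e0 : (0 < gcdn d N)%N by rewrite gcdn_gt0 d0.
case: ifPn => [w_in|w_notin]; last first.
  apply: eq_card0 => s; rewrite inE; apply/negbTE; apply: contra w_notin.
  case/andP; rewrite !inE => /eqP sN /eqP <-.
  by rewrite -exprM muln_divCA_gcd exprM sN expr1n.
have [s0 s0N s0w] : exists2 s0, s0 \in mu L N & s0 ^+ d = w.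
  have NeN : (N %/ gcdn d N %| N)%N.
    by apply/dvdnP; exists (gcdn d N); rewrite mulnC divnK // dvdn_gcdr.
  have wN : w ^+ N = 1 by apply/eqP; move: (mu_dvd NeN w_in); rewrite inE.
  have [[j /= jN] wj] := prim_rootP zN wN; rewrite /= in wj.
  move: w_in; rewrite inE wj -exprM -(prim_order_dvd zN).
  have K0 : (0 < N %/ gcdn d N)%N by rewrite divn_gt0 // dvdn_leq // dvdn_gcdr.
  have NE : N = (N %/ gcdn d N * gcdn d N)%N by rewrite divnK // dvdn_gcdr.
  (* As [w = zeta^j] is killed by [N / gcd], the gcd divides [j]. A Bezout multiple of [d] that is
     the gcd modulo [N] then yields a [d]-th root of [w]. *)
  rewrite mulnC [X in (X %| _)%N]NE dvdn_pmul2l //.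
  case/dvdnP=> j' ->; have [km kn kE _] := egcdnP N d0.
  exists (zeta ^+ (km * j')).
    by rewrite inE exprAC (prim_expr_order zN) expr1n.
  rewrite -exprM mulnAC kE mulnDl -mulnA (mulnCA kn) exprD exprM.
  by rewrite (prim_expr_order zN) expr1n mul1r mulnC.
have s0_neq0 := mu_neq0 N0 s0N.
rewrite -[RHS](card_mu z_prim (dvdn_trans (dvdn_gcdr d N) NM)).
rewrite -(card_imset (mem (mu L (gcdn d N))) (mulfI s0_neq0)).
apply: eq_card => s; rewrite inE; apply/andP/imsetP => [[sN /eqP sw]|[t te ->]].
  exists (s / s0); last by rewrite mulrC divfK.
  move: s0N sN; rewrite !inE => /eqP s0N /eqP sN.
  suff: s / s0 \in mu L (gcdn d N) by rewrite inE.
  by apply: mu_gcd => //; rewrite inE exprMn exprVn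
    ?sw ?s0w ?sN ?s0N ?invr1 ?mulr1 ?divff // -s0w expf_neq0.
move: (mu_dvd (dvdn_gcdl _ _) te) (mu_dvd (dvdn_gcdr _ _) te) s0N.
by rewrite !inE !exprMn s0w => /eqP-> /eqP-> /eqP->; rewrite !mulr1.
Qed.

End RootsOfUnity.

(** * Fibres of [s |-> s + 1/s] on roots of unity *)

Section TraceCount.
Variable L : finFieldType.
Implicit Types (s t w y : L) (N K d : nat).

Lemma eq_addV s t : s != 0 -> t != 0 ->
  (s + s^-1 == t + t^-1) = (s == t) || (s == t^-1).
Proof.
move=> s0 t0; rewrite -subr_eq0.
have -> : s + s^-1 - (t + t^-1) = (s - t) * (s - t^-1) / s.
  by field; rewrite s0 t0.
by rewrite !mulf_eq0 invr_eq0 (negPf s0) orbF !subr_eq0.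
Qed.

(** The fibre through [s] is the pair of [s] and [s^-1], which may coincide. *)
Lemma trace_count_in N s : (0 < N)%N -> s \in mu L N ->
  trace_count N (s + s^-1) = (s != s^-1).+1.
Proof.
move=> N0 sN; rewrite -cards2; apply: eq_card => t; rewrite !inE.
have [->|t0] := eqVneq t 0.
  rewrite expr0n gtn_eqF // [0 == 1]eq_sym oner_eq0 /=.
  by rewrite ![0 == _]eq_sym invr_eq0 (negPf (mu_neq0 N0 sN)).
rewrite eq_addV ?(mu_neq0 N0 sN) //; apply: andb_idl.
by case/orP=> /eqP->; [move: sN | move: (muV sN)]; rewrite inE.
Qed.

Hypothesis L2 : 2%:R != 0 :> L.

Lemma eq_invr s : s != 0 -> (s == s^-1) = (s == 1) || (s == -1).
Proof.
by move=> s0; rewrite -[LHS](inj_eq (mulIf s0)) mulVf // -expr2 -eqf_sqr expr1n.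
Qed.

Lemma eqN11 : (1 == -1 :> L) = false.
Proof. by rewrite -subr_eq0 opprK -[1 + 1]/(2%:R) (negPf L2). Qed.

Lemma trace_count2 N : (0 < N)%N -> trace_count N (2 : L) = 1%N.
Proof.
move=> N0; have := @trace_count_in N 1 N0; rewrite inE expr1n eqxx invr1 eqxx.
by apply.
Qed.

(** The equation [s + 1/s = -2] has the only root [-1], which lies in [mu L N] exactly for even
    [N]. *)
Lemma trace_countN2 N : (0 < N)%N -> trace_count N (- 2 : L) = ~~ odd N.
Proof.
move=> N0; case: (boolP (odd N)) => [oN|eN].
  apply: eq_card0 => s; rewrite !inE; apply/negP => /andP[sN /eqP sE].
  have s0 : s != 0 by apply: (mu_neq0 N0); rewrite inE.
  have : s + s^-1 == -1 + (-1)^-1 by rewrite sE invrN1 -opprD.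
  rewrite eq_addV ?oppr_eq0 ?oner_eq0 // invrN1 orbb => /eqP sN1.
  by move: sN; rewrite sN1 -signr_odd oN expr1 eq_sym eqN11.
have := @trace_count_in N (-1) N0.
rewrite inE -signr_odd (negPf eN) expr0 eqxx invrN1 eqxx -opprD.
by apply.
Qed.

Lemma trace_count_neq N y : (0 < N)%N -> y != 2 -> y != -2 ->
  trace_count N y = 0%N \/ trace_count N y = 2%N.
Proof.
move=> N0 y2 yN2; have [/eqP->|] := boolP (trace_count N y == 0%N); first by left.
rewrite -lt0n => /card_gt0P[s]; rewrite inE => /andP[sN /eqP sy].
right; rewrite -sy trace_count_in // eq_invr ?(mu_neq0 N0 sN) //.
by case: orP => // -[] /eqP sE; move: y2 yN2; rewrite -sy sE ?invr1 ?invrN1 -?opprD eqxx.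
Qed.

(** If both fibres are nonempty, they share an [s], the groups being closed under inversion. Then
    [s^2 = 1], so [s = s^-1] and each fibre is a singleton. *)
Lemma trace_count_add_le N K y : (0 < N)%N -> (0 < K)%N -> gcdn N K = 2%N ->
  (trace_count N y + trace_count K y <= 2)%N.
Proof.
move=> N0 K0 NK.
have aux N1 K1 : (0 < N1)%N -> (0 < K1)%N -> gcdn N1 K1 = 2%N ->
  trace_count N1 y != 0%N -> (trace_count N1 y + trace_count K1 y <= 2)%N.
  move=> N10 K10 NK1; rewrite -lt0n => /card_gt0P[s]; rewrite inE => /andP[sN /eqP sy].
  rewrite -sy trace_count_in //.
  have [->|] := eqVneq (trace_count K1 (s + s^-1)) 0%N; first by rewrite addn0; case: (s == _).
  rewrite -lt0n => /card_gt0P[t]; rewrite inE => /andP[tK].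
  rewrite eq_addV ?(mu_neq0 N10 sN) ?(mu_neq0 K10 tK) // => ts.
  have sK : s \in mu L K1.
    by case/orP: ts => /eqP tE; [rewrite -tE | move: (muV tK); rewrite tE invrK].
  rewrite trace_count_in //.
  have := mu_gcd N10 sN sK; rewrite NK1 inE expr2 => /eqP ss.
  have s0 := mu_neq0 N10 sN.
  by have -> : s == s^-1 by rewrite -(inj_eq (mulIf s0)) mulVf // ss.
have [->|] := eqVneq (trace_count N y) 0%N; last exact: aux.
rewrite add0n; have [->|] := eqVneq (trace_count K y) 0%N; first by [].
by move=> /(aux _ _ K0 N0 (etrans (gcdnC _ _) NK)); apply: leq_trans; rewrite leq_addr.
Qed.

Lemma trace_count_mono K N y : (K %| N)%N -> (trace_count K y <= trace_count N y)%N.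
Proof.
move=> KN; apply/subset_leq_card/subsetP => s; rewrite !inE => /andP[sK ->].
by move: (@mu_dvd _ _ _ s KN); rewrite !inE => ->.
Qed.

End TraceCount.

(** * Double counting, descent to the subfield, and the Dickson identity *)

(** After exchanging the sums, each [s] of [A] is counted at the unique [x] with [iota x = f s],
    provided that this [x] satisfies [P]. *)
Lemma sum_card_image (F L : finType) (iota : F -> L) (A : {set L}) (f : L -> L)
    (P : pred F) (Q : pred L) :
    injective iota -> (forall s, s \in A -> exists x, f s = iota x) ->
    (forall s x, s \in A -> f s = iota x -> P x = Q s) ->
  (\sum_(x | P x) #|[set s in A | f s == iota x]| = #|[set s in A | Q s]|)%N.
Proof.
move=> inj_iota fA PQ.
under eq_bigr => x Px do rewrite -sum1dep_card big_mkcondr /=.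
rewrite exchange_big /= -sum1dep_card big_mkcondr /=; apply: eq_bigr => s sA.
have [x fx] := fA _ sA; rewrite -(PQ s x sA fx).
under eq_bigr => y _ do rewrite fx (inj_eq inj_iota).
by rewrite -big_mkcondr /= sum1dep_card; case: (boolP (P x)) => Px;
  [rewrite (@eq_card1 _ x) // => y | rewrite eq_card0 // => y];
  rewrite !inE ?unfold_in /=; case: eqVneq => [<-|]; rewrite ?Px ?(negPf Px) ?andbF.
Qed.

(** Over [F] the polynomial [X^q - X] is the product of all [X - x], so its roots in [L] are the
    images of the elements of [F]. *)
Lemma expf_card_inv (F : finFieldType) (L : fieldType)
    (iota : {rmorphism F -> L}) (y : L) :
  y ^+ #|F| = y -> exists x, y = iota x.
Proof.
move=> yq; have := congr1 (fun r => (map_poly iota r).[y]) (finField_genPoly F).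
rewrite rmorphB /= map_polyXn map_polyX !hornerE yq subrr rmorph_prod horner_prod.
move/esym/eqP; rewrite prodf_seq_eq0 => /hasP[x _ /=].
by rewrite rmorphB /= map_polyX map_polyC /= !hornerE subr_eq0 => /eqP->; exists x.
Qed.

Lemma exprD_pchar (R : comNzRingType) (p m : nat) (x y : R) :
  p \in [pchar R] -> (x + y) ^+ (p ^ m) = x ^+ (p ^ m) + y ^+ (p ^ m).
Proof.
move=> pR; rewrite exprDn_pchar // pnatX; apply/orP; left.
by rewrite pnatE ?(pcharf_prime pR).
Qed.

Lemma natr_pcharX (R : nzRingType) (p m j : nat) :
  p \in [pchar R] -> j%:R ^+ (p ^ m) = j%:R :> R.
Proof.
move=> pR; elim: m => [|m IHm]; first by rewrite expr1.
by rewrite expnSr exprM IHm -(pFrobenius_autE pR) pFrobenius_aut_nat.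
Qed.

(* With [4 x = (s - 1)^2 / s] and [4 (x + 1) = (s + 1)^2 / s], the powers
   [(s -+ 1)^(2 d)] are computed by the Frobenius. *)
Lemma add_exp_addV (L : fieldType) (p k d : nat) (s x : L) :
    p \in [pchar L] -> 2%:R != 0 :> L -> (2 * d = p ^ k + 1)%N ->
    s != 0 -> s + s^-1 = 4 * x + 2 ->
  2 * ((x + 1) ^+ d + x ^+ d) = s ^+ d + (s ^+ d)^-1.
Proof.
move=> pL L2 dE s0 sx.
have sE : 4 * s * x = s ^+ 2 + 1 - 2 * s.
  have -> : 4 * s * x = (s + s^-1) * s - 2 * s by rewrite sx; ring.
  by rewrite mulrDl mulVf ?expr2.
have x1 : 4 * s * x = (s + (-1)) ^+ 2 by rewrite sE; ring.
have x2 : 4 * s * (x + 1) = (s + 1) ^+ 2 by rewrite mulrDr sE; ring.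
have pN1 : (-1) ^+ (p ^ k) = -1 :> L.
  have := exprD_pchar k (1 : L) (-1) pL.
  rewrite subrr expr1n expr0n eqn0Ngt expn_gt0 prime_gt0 ?(pcharf_prime pL) //=.
  by move/eqP; rewrite eq_sym addrC addr_eq0 => /eqP.
(* [4^d = 2^(2 d) = 2^(p^k) * 2], and the Frobenius fixes 2. *)
have e4 : 4 ^+ d = 4 :> L.
  have -> : (4 : L) = 2%:R ^+ 2 by rewrite -natrX.
  by rewrite -exprM dE addn1 exprSr natr_pcharX.
have e1 : 4 * s ^+ d * x ^+ d = (s ^+ (p ^ k) - 1) * (s - 1).
  by rewrite -{1}e4 -!exprMn x1 -exprM dE addn1 exprSr exprD_pchar // pN1.
have e2 : 4 * s ^+ d * (x + 1) ^+ d = (s ^+ (p ^ k) + 1) * (s + 1).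
  by rewrite -{1}e4 -!exprMn x2 -exprM dE addn1 exprSr exprD_pchar // expr1n.
have e3 : s ^+ d * s ^+ d = s ^+ (p ^ k) * s by rewrite -exprD addnn -mul2n dE addn1 exprSr.
have sd0 : s ^+ d != 0 by rewrite expf_neq0.
apply: (mulfI (mulf_neq0 L2 sd0)).
have -> : 2 * s ^+ d * (2 * ((x + 1) ^+ d + x ^+ d)) =
    4 * s ^+ d * (x + 1) ^+ d + 4 * s ^+ d * x ^+ d by ring.
have -> : 2 * s ^+ d * (s ^+ d + (s ^+ d)^-1) = 2 * (s ^+ d * s ^+ d) + 2 by field.
by rewrite e1 e2 e3; ring.
Qed.

Lemma natr2_neq0 (R : nzRingType) (p : nat) :
  p \in [pchar R] -> odd p -> 2%:R != 0 :> R.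
Proof.
move=> pR p_odd; rewrite -(dvdn_pcharf pR); apply: contraL p_odd => p2.
by move: p2; rewrite dvdn_prime2 ?(pcharf_prime pR) // => /eqP->.
Qed.

(** * Fibres of [x |-> (x + 1)^d + x^d] counted through roots of unity *)

Section DicksonCount.
Variables (p n k d : nat) (F L : finFieldType) (iota : {rmorphism F -> L}) (z : L).
Hypotheses (pF : p \in [pchar F]) (cardF : #|F| = (p ^ n)%N).
Hypothesis q_gt1 : (1 < p ^ n)%N.
Hypothesis z_prim : ((p ^ n - 1) * (p ^ n + 1)).-primitive_root z.
Local Notation q := (p ^ n)%N.
Implicit Type (x b : F) (N : nat).

Let pL : p \in [pchar L]. Proof. by rewrite (fmorph_pchar iota). Qed.

Let dvd1 : (q - 1 %| (q - 1) * (q + 1))%N. Proof. exact: dvdn_mulr. Qed.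
Let dvd2 : (q + 1 %| (q - 1) * (q + 1))%N. Proof. exact: dvdn_mull. Qed.

(** Here [s^q] is [s] or [s^-1], so raising to the power [q] fixes [s + s^-1]. *)
Lemma addV_in_subfield N s : (N == q - 1)%N || (N == q + 1)%N ->
  s \in mu L N -> exists x, s + s^-1 = iota x.
Proof.
move=> NE sN.
have N0 : (0 < N)%N by case/orP: NE => /eqP->; rewrite ?addn1 ?subn_gt0.
have s0 := mu_neq0 N0 sN.
apply: expf_card_inv; rewrite cardF exprD_pchar // exprVn.
move: sN; rewrite inE => /eqP sN; case/orP: NE => /eqP NE.
  by have -> : q = N.+1 by [rewrite NE subn1 prednK // ltnW]; rewrite exprS sN mulr1.
suff -> : s ^+ q = s^-1 by rewrite invrK addrC.
by apply: (mulfI s0); rewrite mulfV // -exprS -addn1 -NE.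
Qed.

Lemma sum_trace_count K N :
    (N == q - 1)%N || (N == q + 1)%N -> (N %| (q - 1) * (q + 1))%N -> (K %| N)%N ->
  (\sum_(x : F) trace_count K (iota x) = K)%N.
Proof.
move=> NE NM KN.
rewrite (@sum_card_image _ _ iota (mu L K) (fun s => s + s^-1) xpredT xpredT) //.
- rewrite -[RHS](card_mu z_prim (dvdn_trans KN NM)).
  by apply: eq_card => s; rewrite inE andbT.
- exact: fmorph_inj.
- by move=> s /(mu_dvd KN); exact: addV_in_subfield.
Qed.

Hypothesis p_odd : odd p.

(** Each of these sums is at most 2 because [gcd(q - 1, q + 1) = 2]. Over all of [F] they add up to
    [(q - 1) + (q + 1) = 2 q], which forces equality at every [y]. *)
Lemma trace_count_total (y : F) :
  (trace_count (q - 1) (iota y) + trace_count (q + 1) (iota y) = 2)%N.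
Proof.
have /gcdn_pred_succ gcdq : odd q by rewrite oddX p_odd orbT.
have le2 (x : F) : true ->
    (trace_count (q - 1) (iota x) + trace_count (q + 1) (iota x) <= 2 ?= iff
      (trace_count (q - 1) (iota x) + trace_count (q + 1) (iota x) == 2))%N.
  move=> _; apply/leqif_eq/trace_count_add_le => //; lia.
have /leqif_sum[_] := le2.
rewrite big_split /= (@sum_trace_count _ (q - 1)) ?eqxx //.
rewrite (@sum_trace_count _ (q + 1)) ?eqxx ?orbT //.
rewrite sum_nat_const cardF; have -> : (q - 1 + (q + 1) == q * 2)%N by lia.
by move/esym/forallP/(_ y)/eqP.
Qed.

Hypotheses (dE : (2 * d = p ^ k + 1)%N) (d_gt0 : (0 < d)%N).

(** By the Dickson identity the left side counts the [s] in [mu L N] with [s^d + s^-d = 2 b]; these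
    are then grouped by [w = s^d]. *)
Lemma sum_trace_count_fiber N b :
    (N == q - 1)%N || (N == q + 1)%N -> (N %| (q - 1) * (q + 1))%N ->
  (\sum_(x | ((x + 1) ^+ d + x ^+ d == b)%R)
       trace_count N (iota (4 * x + 2)%R) =
     gcdn d N * trace_count (N %/ gcdn d N) (iota (2 * b)%R))%N.
Proof.
move=> NE NM.
have N0 : (0 < N)%N by case/orP: NE => /eqP->; rewrite ?addn1 ?subn_gt0.
have L2 : 2%:R != 0 :> L by apply: (@natr2_neq0 _ p).
have F2 : 2%:R != 0 :> F by apply: (@natr2_neq0 _ p).
have F4 : 4 != 0 :> F.
  by have -> : 4 = 2%:R * 2%:R :> F; [rewrite -natrM | rewrite mulf_neq0].
have inj4 : injective (fun x : F => iota (4 * x + 2)).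
  by move=> x y /fmorph_inj/addIr/(mulfI F4).
rewrite (@sum_card_image _ _ (fun x : F => iota (4 * x + 2)) (mu L N)
  (fun s => s + s^-1) _ (fun s => s ^+ d + (s ^+ d)^-1 == iota (2 * b))) //; first last.
- move=> s x sN sx; rewrite -(@add_exp_addV _ p k d s (iota x)) ?(mu_neq0 N0 sN) //.
    have <- : iota (2 * ((x + 1) ^+ d + x ^+ d)) =
        2 * ((iota x + 1) ^+ d + iota x ^+ d).
      by rewrite rmorphM rmorph_nat rmorphD !rmorphXn /= rmorphD rmorph1.
    by rewrite (inj_eq (fmorph_inj iota)) (inj_eq (mulfI F2)).
  by rewrite sx rmorphD rmorphM !rmorph_nat.
- move=> s sN; have [x ->] := addV_in_subfield NE sN.
  by exists ((x - 2) / 4); rewrite mulrCA divff // mulr1 subrK.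
(* Regrouping by [w]: each [w] of the image has [gcdn d N] preimages. *)
rewrite -(@sum_card_image _ _ id (mu L N) (fun s => s ^+ d)
  (fun w => w + w^-1 == iota (2 * b))) //.
- under eq_bigr => w _ do rewrite (card_pow_fiber _ z_prim NM d_gt0).
  rewrite -big_mkcondr sum_nat_cond_const mulnC; congr (_ * _)%N.
  by apply: eq_card => w; rewrite !inE andbC.
- by move=> s sN; exists (s ^+ d).
- by move=> s x _ <-.
Qed.

(* A value [y] of the subfield has two preimages under [s |-> s + 1/s]
   among the roots of unity of orders [q - 1] and [q + 1]. *)
Lemma double_card_fiber b :
  (2 * #|[set x : F | ((x + 1) ^+ d + x ^+ d == b)%R]| =
     gcdn d (q - 1) * trace_count ((q - 1) %/ gcdn d (q - 1)) (iota (2 * b)%R) +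
     gcdn d (q + 1) * trace_count ((q + 1) %/ gcdn d (q + 1)) (iota (2 * b)%R))%N.
Proof.
rewrite -!sum_trace_count_fiber ?eqxx ?orbT //.
rewrite -big_split /=; under eq_bigr => x _ do rewrite trace_count_total.
by rewrite sum_nat_const mulnC cardsE.
Qed.
End DicksonCount.

(** * Level sets of [f * a + c] *)

(* To be applied with [N b] the number of solutions of [(x + 1)^d + x^d = b], and
   [a b], [c b] the numbers of [w] with [w + 1/w = 2 b] in the two images. *)
Section LevelSets.
Local Open Scope nat_scope.
Variables (T : finType) (f : nat) (a c N : T -> nat) (b1 b2 : T).
Hypotheses (f_gt2 : 2 < f) (b12 : b1 != b2).
Hypothesis NE : forall b, N b = f * a b + c b.
Hypotheses (ab1 : a b1 = 1) (cb1 : c b1 = 1) (ab2 : a b2 = 1) (cb2 : c b2 = 0).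
Hypothesis ac : forall b, b != b1 -> b != b2 ->
  [\/ a b = 0 /\ c b = 0, a b = 2 /\ c b = 0 | a b = 0 /\ c b = 2].

Local Notation w i := #|[set b | N b == i]|.

Let sum_w i : \sum_b (N b == i) = w i.
Proof. by rewrite -sum1dep_card [RHS]big_mkcond; apply: eq_bigr => b _; case: eqP. Qed.

(** As [f > 2], the values 0, 2, [f], [f + 1] and [2 f] are distinct, so [N b] determines [a b] and
    [c b]. *)
Let casesb b : [\/ [/\ b = b1, a b = 1, c b = 1 & N b = f.+1],
  [/\ b = b2, a b = 1, c b = 0 & N b = f] | [/\ b != b1, b != b2 &
  [\/ [/\ a b = 0, c b = 0 & N b = 0], [/\ a b = 2, c b = 0 & N b = 2 * f]
    | [/\ a b = 0, c b = 2 & N b = 2] ]]].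
Proof.
rewrite NE; have [->|bn1] := eqVneq b b1;
  first by constructor 1; rewrite ab1 cb1; split=> //; lia.
have [->|bn2] := eqVneq b b2; first by constructor 2; rewrite ab2 cb2; split=> //; lia.
constructor 3; split=> //.
by case: (ac bn1 bn2) => -[-> ->]; [constructor 1|constructor 2|constructor 3]; split=> //; lia.
Qed.

Lemma level_f : w f = 1.
Proof.
rewrite -(cards1 b2); apply: eq_card => b; rewrite !inE.
case: (casesb b) => [[-> _ _ ->]|[-> _ _ ->]|[_ /negPf-> [] [_ _ ->]]];
  first by rewrite (negPf b12); lia.
all: by rewrite ?eqxx; lia.
Qed.

Lemma level_fS : w f.+1 = 1.
Proof.
rewrite -(cards1 b1); apply: eq_card => b; rewrite !inE.
case: (casesb b) => [[-> _ _ ->]|[-> _ _ ->]|[/negPf-> _ [] [_ _ ->]]]; last 3 first.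
all: by rewrite ?eqxx // ?[b2 == _]eq_sym ?(negPf b12); lia.
Qed.

(** Each [b] at level [2 f] contributes 2; [b1] and [b2] contribute 1 each. *)
Lemma level_double : \sum_b a b = 2 * w (2 * f) + 2.
Proof.
have -> : 2 * w (2 * f) + 2 = 2 * w (2 * f) + (w f + w f.+1).
  by rewrite level_f level_fS.
rewrite -!sum_w big_distrr -!big_split /=.
by apply: eq_bigr => b _;
  case: (casesb b) => [[_ -> _ ->]|[_ -> _ ->]|[_ _ [] [-> _ ->]]]; lia.
Qed.

Lemma level_two : \sum_b c b = 2 * w 2 + 1.
Proof.
have -> : 2 * w 2 + 1 = 2 * w 2 + w f.+1 by rewrite level_fS.
rewrite -!sum_w big_distrr -!big_split /=.
by apply: eq_bigr => b _;
  case: (casesb b) => [[_ _ -> ->]|[_ _ -> ->]|[_ _ [] [_ -> ->]]]; lia.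
Qed.

Lemma level_zero : #|T| = w 0 + w 2 + w (2 * f) + 2.
Proof.
have -> : w 0 + w 2 + w (2 * f) + 2 = w 0 + w 2 + w (2 * f) + (w f + w f.+1).
  by rewrite level_f level_fS.
rewrite -!sum_w -!big_split -sum1_card /=.
by apply: eq_bigr => b _;
  case: (casesb b) => [[_ _ _ ->]|[_ _ _ ->]|[_ _ [] [_ _ ->]]]; lia.
Qed.

Lemma level_other i : i \notin [:: 0; 2; f; f.+1; 2 * f] -> w i = 0.
Proof.
rewrite !inE => ni; apply: eq_card0 => b; rewrite !inE; apply: contraNF ni => /eqP <-.
by case: (casesb b) => [[_ _ _ ->]|[_ _ _ ->]|[_ _ [] [_ _ ->]]]; rewrite eqxx ?orbT.
Qed.

End LevelSets.

(** * Equations for the spectrum and their solution *)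

(** [NA] is the one of [p^n - 1] and [p^n + 1] whose gcd with [d] is [2 f]; [NB] is the other one,
    with gcd 2. The equations for [NA] and [NB] compare the sums of [a] and [c] with the orders of
    the two images. *)
Lemma comega_half_exp (p n k d f NA NB : nat) (F : finFieldType) :
    p \in [pchar F] -> #|F| = (p ^ n)%N -> (0 < n)%N -> (p + 1 = 4 * f)%N ->
    (2 < f)%N -> (2 * d = p ^ k + 1)%N -> odd k -> coprime k n ->
    (NA = if odd n then p ^ n + 1 else p ^ n - 1)%N ->
    (NB = if odd n then p ^ n - 1 else p ^ n + 1)%N ->
  let w := comega (@power_fun F d) (-1) in
  [/\ w f = 1%N, w f.+1 = 1%N,
      NA = (2 * f * (2 * w (2 * f)%N + 2))%N, NB = (2 * (2 * w 2 + 1))%N &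
      (p ^ n = w 0 + w 2 + w (2 * f)%N + 2)%N /\
      forall i, i \notin [:: 0; 2; f; f.+1; 2 * f]%N -> w i = 0%N].
Proof.
move=> pF cardF n_gt0 pE f_gt2 dE k_odd co_kn NAE NBE w.
have f_gt0 : (0 < f)%N by apply: leq_trans f_gt2.
have p_pr := pcharf_prime pF; have p_odd : odd p by lia.
have d_gt0 : (0 < d)%N by rewrite -(ltn_pmul2l (isT : 0 < 2)%N) dE muln0 addn1.
have q_gt1 : (1 < p ^ n)%N by rewrite -(exp1n n) ltn_exp2r ?prime_gt1.
have q0 : (0 < p ^ n)%N by apply: ltnW.
(* This product is [-1] in characteristic [p], so an extension contains a root of unity of that
   order. *)
have M0 : ((p ^ n - 1) * (p ^ n + 1))%:R != 0 :> F.
  have qF : (p ^ n)%:R = 0 :> F by apply/eqP; rewrite -(dvdn_pcharf pF) dvdn_exp.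
  rewrite natrM natrB // natrD qF.
  by rewrite !add0r mulr1 oppr_eq0 oner_eq0.
have [L [iota [z z_prim]]] := ex_prim_root_ext M0.
have F2 : 2%:R != 0 :> F by apply: natr2_neq0 pF p_odd.
have L2 : 2%:R != 0 :> L by rewrite -(rmorph_nat iota) fmorph_eq0.
have NA_in : (NA == p ^ n - 1)%N || (NA == p ^ n + 1)%N.
  by rewrite NAE; case: odd; rewrite eqxx ?orbT.
have NB_in : (NB == p ^ n - 1)%N || (NB == p ^ n + 1)%N.
  by rewrite NBE; case: odd; rewrite eqxx ?orbT.
have [gA oA] : gcdn d NA = (2 * f)%N /\ ~~ odd (NA %/ (2 * f))%N.
  apply: (@gcd_exponent_half p n k) => //.
  by rewrite NAE; case: odd; rewrite ?eqxx // pred_eq_succ.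
have [gB oB] : gcdn d NB = 2%N /\ odd (NB %/ 2)%N.
  apply: (@gcd_exponent_two p n k d f) => //.
  by rewrite NBE; case: odd; rewrite ?eqxx // eq_sym eqbF_neg eq_sym pred_eq_succ.
have dvdA : (2 * f %| NA)%N by rewrite -gA dvdn_gcdr.
have dvdB : (2 %| NB)%N by rewrite -gB dvdn_gcdr.
have NA0 : (0 < NA)%N by rewrite NAE; case: odd; rewrite ?addn1 // subn_gt0.
have NB0 : (0 < NB)%N by rewrite NBE; case: odd; rewrite ?addn1 // subn_gt0.
have KA0 : (0 < NA %/ (2 * f))%N by rewrite divn_gt0 ?muln_gt0 // dvdn_leq.
have KB0 : (0 < NB %/ 2)%N by rewrite divn_gt0 // dvdn_leq.
have NAM : (NA %| (p ^ n - 1) * (p ^ n + 1))%N.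
  by case/orP: NA_in => /eqP->; [apply: dvdn_mulr | apply: dvdn_mull].
have NBM : (NB %| (p ^ n - 1) * (p ^ n + 1))%N.
  by case/orP: NB_in => /eqP->; [apply: dvdn_mulr | apply: dvdn_mull].
have KAN : (NA %/ (2 * f) %| NA)%N by apply/dvdnP; exists (2 * f)%N; rewrite mulnC divnK.
have KBN : (NB %/ 2 %| NB)%N by apply/dvdnP; exists 2%N; rewrite mulnC divnK.
have gAB : gcdn NA NB = 2%N.
  have /gcdn_pred_succ g2 : odd (p ^ n) by rewrite oddX p_odd orbT.
  by rewrite NAE NBE; case: odd; rewrite // gcdnC.
pose a b := trace_count (NA %/ (2 * f)) (iota (2 * b)).
pose c b := trace_count (NB %/ 2) (iota (2 * b)).
have DE b : cdelta (@power_fun F d) (-1) 1 b = (f * a b + c b)%N.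
  have := double_card_fiber iota pF cardF q_gt1 z_prim p_odd dE d_gt0 b.
  have -> : #|[set x : F | (x + 1) ^+ d + x ^+ d == b]| =
      cdelta (@power_fun F d) (-1) 1 b.
    by apply: eq_card => x; rewrite !inE /power_fun mulN1r opprK.
  move=> cdeltaE; apply/eqP; rewrite -(eqn_pmul2l (isT : 0 < 2)%N) {}cdeltaE.
  rewrite /a /c; move: NAE NBE gA gB; case: odd => -> -> -> ->.
    by rewrite mulnDr mulnA addnC.
  by rewrite mulnDr mulnA.
have io1 : iota (2 * 1) = 2 by rewrite mulr1 rmorph_nat.
have ioN1 : iota (2 * -1) = -2 by rewrite mulrN mulr1 rmorphN rmorph_nat.
(* Since [b |-> 2 b] permutes [F], the sums of [a] and [c] run over all subfield values. *)
have bij2 : bijective (fun x : F => 2 * x) by exact: injF_bij (mulfI F2).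
have suma : (\sum_b a b = NA %/ (2 * f))%N.
  rewrite -[RHS](sum_trace_count iota pF cardF q_gt1 z_prim NA_in NAM KAN).
  by rewrite [RHS](reindex _ (onW_bij _ bij2)).
have sumc : (\sum_b c b = NB %/ 2)%N.
  rewrite -[RHS](sum_trace_count iota pF cardF q_gt1 z_prim NB_in NBM KBN).
  by rewrite [RHS](reindex _ (onW_bij _ bij2)).
have b12 : 1 != -1 :> F by rewrite -subr_eq0 opprK.
have a1 : a 1 = 1%N by rewrite /a io1 trace_count2.
have c1 : c 1 = 1%N by rewrite /c io1 trace_count2.
have a2 : a (-1) = 1%N by rewrite /a ioN1 trace_countN2 // oA.
have c2 : c (-1) = 0%N by rewrite /c ioN1 trace_countN2 // oB.
have ac b : b != 1 -> b != -1 ->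
  [\/ a b = 0 /\ c b = 0, a b = 2 /\ c b = 0 | a b = 0 /\ c b = 2]%N.
  move=> bn1 bn2.
  have y1 : iota (2 * b) != 2 by rewrite -io1 (inj_eq (fmorph_inj _)) (inj_eq (mulfI F2)).
  have y2 : iota (2 * b) != -2 by rewrite -ioN1 (inj_eq (fmorph_inj _)) (inj_eq (mulfI F2)).
  have le2 : (a b + c b <= 2)%N.
    apply: leq_trans (trace_count_add_le (iota (2 * b)) NA0 NB0 gAB).
    by rewrite leq_add // trace_count_mono.
  have := trace_count_neq KA0 y1 y2; have := trace_count_neq KB0 y1 y2.
  (* Both counts are 0 or 2, and the bound [le2] excludes that both are 2. *)
  rewrite -/(a b) -/(c b) => -[cE|cE] [aE|aE]; rewrite aE cE in le2 *; by [constructor | |].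
split.
- exact: (level_f f_gt2 b12 DE a1 c1 a2 c2 ac).
- exact: (level_fS f_gt2 b12 DE a1 c1 a2 c2 ac).
- rewrite -(level_double f_gt2 b12 DE a1 c1 a2 c2 ac).
  by rewrite suma mulnC divnK.
- rewrite -(level_two f_gt2 b12 DE a1 c1 a2 c2 ac).
  by rewrite sumc mulnC divnK.
- split; first by rewrite -cardF; exact: (level_zero f_gt2 b12 DE a1 c1 a2 c2 ac).
  exact: (level_other f_gt2 b12 DE a1 c1 a2 c2 ac).
Qed.

(** If [k = 2 j], then [gcd(2 n, k) = 2 gcd(n, j) = 2] and the quotient is [n], which is odd by
    coprimality with the even [k]. *)
Lemma odd_of_even_quo n k : gcdn n k = 1%N ->
  ~~ odd ((2 * n) %/ gcdn (2 * n) k)%N -> odd k.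
Proof.
move=> nk; apply: contraR => k_even.
have [j kE] : exists j, k = (2 * j)%N.
  by exists k./2; rewrite mul2n -[LHS]odd_double_half (negPf k_even).
have nj : gcdn n j = 1%N.
  by apply/eqP; rewrite -dvdn1 -nk dvdn_gcd dvdn_gcdl kE dvdn_mull // dvdn_gcdr.
rewrite kE -muln_gcdr nj mulKn //.
apply: contraT => n_even; have : (2 %| gcdn n k)%N by rewrite dvdn_gcd !dvdn2 n_even k_even.
by rewrite nk.
Qed.

(** [P] and [q] stand for [p] and [p^n]; [Z], [V] and [W] stand for the spectrum at 0, 2 and
    [(p + 1)/2]. The last equation counts all [b], the final 2 being the two exceptional values. *)
Lemma spectrum_values_odd (P q W V Z : rat) : P + 1 != 0 ->
    q + 1 = (P + 1) * (W + 1) -> q = 4 * V + 3 -> q = Z + V + W + 2 ->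
  [/\ Z = (q * (3 * P - 1) - (P + 5)) / (4 * (P + 1)), V = (q - 3) / 4 &
      W = (q - P) / (P + 1)].
Proof.
move=> P1 qW qV qZ; have VE : V = (q - 3) / 4 by rewrite qV; field.
have WE : W = (q - P) / (P + 1) by rewrite -[q](addrK 1) qW; field.
split=> //; have -> : Z = q - V - W - 2 by rewrite qZ; ring.
by rewrite VE WE; field.
Qed.

Lemma spectrum_values_even (P q W V Z : rat) : P + 1 != 0 ->
    q - 1 = (P + 1) * (W + 1) -> q = 4 * V + 1 -> q = Z + V + W + 2 ->
  [/\ Z = (q - 1) * (3 * P - 1) / (4 * (P + 1)), V = (q - 1) / 4 &
      W = (q - P - 2) / (P + 1)].
Proof.
move=> P1 qW qV qZ; have VE : V = (q - 1) / 4 by rewrite qV; field.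
have WE : W = (q - P - 2) / (P + 1) by rewrite -[q](subrK 1) qW; field.
split=> //; have -> : Z = q - V - W - 2 by rewrite qZ; ring.
by rewrite VE WE; field.
Qed.

Theorem theorem12 (p n k : nat) (F : finFieldType)
    (p_prime : prime p) (p_gt7 : (7 < p)%N) (p_mod4 : (p = 3 %[mod 4])%N)
    (n_gt0 : (0 < n)%N) (k_gt0 : (0 < k)%N)
    (co_nk : gcdn n k = 1%N)
    (even_quo : ~~ odd ((2 * n) %/ gcdn (2 * n) k))
    (cardF : #|F| = (p ^ n)%N) :
  (odd n ->
     has_cdiff_spectrum (@power_fun F ((p ^ k + 1) %/ 2)%N) (-1)
       [:: (0%N, (p%:R ^+ n * (3 * p%:R - 1) - (p%:R + 5)) / (4 * (p%:R + 1)));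
           (2%N, (p%:R ^+ n - 3) / 4);
           (((p + 1) %/ 4)%N, 1);
           (((p + 5) %/ 4)%N, 1);
           (((p + 1) %/ 2)%N, (p%:R ^+ n - p%:R) / (p%:R + 1))]) /\
  (~~ odd n ->
     has_cdiff_spectrum (@power_fun F ((p ^ k + 1) %/ 2)%N) (-1)
       [:: (0%N, (p%:R ^+ n - 1) * (3 * p%:R - 1) / (4 * (p%:R + 1)));
           (2%N, (p%:R ^+ n - 1) / 4);
           (((p + 1) %/ 4)%N, 1);
           (((p + 5) %/ 4)%N, 1);
           (((p + 1) %/ 2)%N, (p%:R ^+ n - p%:R - 2) / (p%:R + 1))]).
Proof.
have k_odd := odd_of_even_quo co_nk even_quo.
have pF : p \in [pchar F] by apply: card_finPcharP cardF p_prime.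
pose f := ((p + 1) %/ 4)%N.
have pE : (p + 1 = 4 * f)%N by rewrite /f; move: p_mod4; clear; lia.
(* This is where [p > 7] enters: it keeps the five listed indices distinct. *)
have f_gt2 : (2 < f)%N by move: pE p_gt7; clear; lia.
have -> : ((p + 5) %/ 4 = f.+1)%N by move: pE; clear; lia.
have -> : ((p + 1) %/ 2 = 2 * f)%N by move: pE; clear; lia.
rewrite -/f; set d := ((p ^ k + 1) %/ 2)%N.
have dE : (2 * d = p ^ k + 1)%N.
  by rewrite mulnC divnK // dvdn2 addn1 /= negbK oddX; move: pE; clear; lia.
have co_kn : coprime k n by rewrite coprime_sym; apply/eqP.
have [wf wfS wA wB [wq wi]] :=
  comega_half_exp pF cardF n_gt0 pE f_gt2 dE k_odd co_kn erefl erefl.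
have q0 : (0 < p ^ n)%N by rewrite expn_gt0 prime_gt0.
have PE : p%:R + 1 = 4 * f%:R :> rat by rewrite -(natrD _ p 1%N) pE natrM.
have P0 : p%:R + 1 != 0 :> rat by rewrite natr1 Num.Theory.pnatr_eq0.
move: wf wfS wA wB wq wi; set w := comega _ _ => wf wfS wA wB wq wi.
have qZ : p%:R ^+ n = (w 0%N)%:R + (w 2)%:R + (w (2 * f)%N)%:R + 2 :> rat.
  by rewrite -natrX wq !natrD.
split=> n_odd; rewrite ?n_odd ?(negPf n_odd) in wA wB; (split; last exact: wi).
- have qW : p%:R ^+ n + 1 = (p%:R + 1) * ((w (2 * f)%N)%:R + 1) :> rat.
    by rewrite PE -natrX -(natrD _ _ 1%N) wA !natrM natrD natrM; ring.
  have qV : p%:R ^+ n = 4 * (w 2)%:R + 3 :> rat.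
    have qn : (p ^ n = 4 * w 2%N + 3)%N by move: wB q0; clear; lia.
    by rewrite -natrX qn natrD natrM.
  have [eZ eV eW] := spectrum_values_odd P0 qW qV qZ.
  move=> iv; rewrite !inE.
  by case/or4P => [/eqP->|/eqP->|/eqP->|/orP[/eqP->|/eqP->]]; rewrite /= -/w ?wf ?wfS.
have qW : p%:R ^+ n - 1 = (p%:R + 1) * ((w (2 * f)%N)%:R + 1) :> rat.
  by rewrite PE -natrX -(natrB _ q0) wA !natrM natrD natrM; ring.
have qV : p%:R ^+ n = 4 * (w 2)%:R + 1 :> rat.
  have qn : (p ^ n = 4 * w 2%N + 1)%N by move: wB q0; clear; lia.
  by rewrite -natrX qn natrD natrM.
have [eZ eV eW] := spectrum_values_even P0 qW qV qZ.
move=> iv; rewrite !inE.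
by case/or4P => [/eqP->|/eqP->|/eqP->|/orP[/eqP->|/eqP->]]; rewrite /= -/w ?wf ?wfS.
Qed.
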